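(* Let $K$ be a field, let $f$ be any polynomial in the free algebra $K\langle X\rangle$, and let $m$ be the maximum degree of an indeterminate appearing in $f$. (1) If $|K|\ge m+1$, then $f$ is algebraically concise. (2) If $|K|\ge m$ and $f$ is homogeneous, then $f$ is algebraically concise. In particular, if either $K$ is infinite or $K$ is finite and $f$ is multilinear, then $f$ is algebraically concise.
   Context: ''Algebra'' means a not necessarily unital associative algebra over the fixed field $K$. $K\langle X\rangle$ is the free associative $K$-algebra on $X=\{x_1,x_2,\ldots\}$; polynomials are taken with zero constant term, so that they can be evaluated in any algebra. For an algebra $A$ and $f=f(x_1,\ldots,x_n)\in K\langle X\rangle$, let $\mathcal S_A(f)$ and $\mathcal A_A(f)$ be, respectively, the $K$-subspace and the $K$-subalgebra of $A$ generated by the set of $f$-values $\{f(a_1,\ldots,a_n): a_1,\ldots,a_n\in A\}$. The polynomial $f$ is algebraically concise if, for every $K$-algebra $A$, $\mathcal A_A(f)$ is finite-dimensional whenever $\mathcal S_A(f)$ is finite-dimensional. A polynomial is homogeneous if the degree of each indeterminate appearing in it does not vary among its monomials (i.e. it is multihomogeneous). A polynomial is multilinear if every indeterminate appearing in it has degree exactly one in each of its monomials. *)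

(* Defs.v *)
From HB Require Import structures.
From mathcomp Require Import all_boot all_algebra.
From mathcomp Require Import finmap monalg.
From mathcomp Require Import boolp classical_sets functions cardinality.

Set Implicit Arguments.
Unset Strict Implicit.
Unset Printing Implicit Defensive.

Import GRing.Theory.

Local Open Scope classical_set_scope.
Local Open Scope ring_scope.

(* A not necessarily unital associative K-algebra: a K-vector space which is
   also a semigroup, with bilinear product. The product is the semigroup law
   mul of group_scope, since the product of ring_scope requires a unit. *)
HB.mixin Record isBilinearProduct (K : fieldType) A
    of Semigroup A & GRing.Lmodule K A := {
  assoc_mulDl : forall x y z : A, ((x + y) * z)%g = (x * z)%g + (y * z)%g;
  assoc_mulDr : forall x y z : A, (x * (y + z))%g = (x * y)%g + (x * z)%g;
  assoc_scaleAl : forall (c : K) (x y : A), ((c *: x) * y)%g = c *: (x * y)%g;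
  assoc_scaleAr : forall (c : K) (x y : A), (x * (c *: y))%g = c *: (x * y)%g
}.

#[short(type="assocAlgType")]
HB.structure Definition AssocAlgebra (K : fieldType) :=
  { A of Semigroup A & GRing.Lmodule K A & isBilinearProduct K A }.

(* The free unital associative algebra on x_0, x_1, ..., as the algebra of the
   free monoid on nat. *)
Notation "{ 'free' K }" := {malg K[{fmonom nat}]}
  (at level 0, K at level 2, format "{ 'free'  K }") : type_scope.

Section Polynomials.
Variable K : fieldType.
Implicit Types f : {free K}.

Definition vars f : seq nat :=
  undup (flatten [seq (w : seq nat) | w : {fmonom nat} <- msupp f]).

Definition deg_mon (i : nat) (w : {fmonom nat}) : nat := count_mem i w.

Definition max_deg f : nat :=
  \max_(i <- vars f) \max_(w <- msupp f) deg_mon i w.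

Definition homogeneous f : Prop :=
  forall i, i \in vars f ->
  {in msupp f &, forall w w', deg_mon i w = deg_mon i w'}.

Definition multilinear f : Prop :=
  forall i, i \in vars f -> {in msupp f, forall w, deg_mon i w = 1%N}.

End Polynomials.

Section Algebras.
Variables (K : fieldType) (A : assocAlgType K).
Implicit Types (f : {free K}) (V : set A).

(* The value 0 at the empty word is junk, as A may have no unit: eval is only
   meaningful for polynomials with zero constant term. *)
Definition eval_mon (a : nat -> A) (w : {fmonom nat}) : A :=
  if (w : seq nat) is i :: s then foldl (fun x j => (x * a j)%g) (a i) s else 0.

Definition eval f (a : nat -> A) : A :=
  \sum_(w <- msupp f) f@_w *: eval_mon a w.

Definition values f : set A := range (eval f).

Definition is_subspace V : Prop :=
  V 0 /\ forall (c : K) u v, V u -> V v -> V (c *: u + v).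

Definition is_subalgebra V : Prop :=
  is_subspace V /\ forall u v, V u -> V v -> V (u * v)%g.

Definition subspace_gen (X : set A) : set A := smallest is_subspace X.

Definition subalgebra_gen (X : set A) : set A := smallest is_subalgebra X.

Definition finite_dimensional V : Prop :=
  exists2 X : set A, finite_set X & V = subspace_gen X.

End Algebras.

Arguments values {K} A f.

Definition algebraically_concise (K : fieldType) (f : {free K}) : Prop :=
  forall A : assocAlgType K,
    finite_dimensional (subspace_gen (values A f)) ->
    finite_dimensional (subalgebra_gen (values A f)).

(* Main.v *)
(** If [V = span (values A f)] is finite-dimensional, then it is a Lie ideal:
    [f(a), c] is the sum over i of the coefficients of [t] in
    f(.., a_i + t [a_i, c], ..), and Vandermonde matrices extract these
    coefficients inside [V].  Then the largest ideal [I] contained in [V + V^2]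
    contains [V, V].

    Let v = g(a) be a value, where [g] is homogeneous of degree j > 0 in x_i,
    and put z = v^2.  The ideal [J] generated by [z, A] satisfies J^2 <= I, in
    every characteristic.  Modulo [J], [z] is central, so that replacing a_i by
    z^k a_i turns v into z^(kj) v.  These elements of [V] are linearly
    dependent, whence p(v) is in [J] for some p <> 0, so p(v)^2 is in [I], and
    [v] is algebraic because [I] lies in a finite-dimensional space.

    Finally a finite-dimensional Lie algebra spanned by finitely many algebraic
    elements generates a finite-dimensional algebra: up to shorter products, the
    letters of a product commute, so in a long product a high power of some
    letter can be formed and shortened. *)
From HB Require Import structures.
Require Import Defs.
From mathcomp Require Import all_boot all_algebra.
From mathcomp Require Import finmap monalg.
From mathcomp Require Import boolp classical_sets functions cardinality.

Set Implicit Arguments.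
Unset Strict Implicit.
Unset Printing Implicit Defensive.

Import GRing.Theory.

Local Open Scope card_scope.
Local Open Scope classical_set_scope.
Local Open Scope ring_scope.

Local Notation "x ** y" := (x * y)%g (at level 40, left associativity).
Local Notation span s := (subspace_gen [set` s]).
Local Notation comm x y := (x ** y - y ** x).

(** * Subspaces of non-unital algebras *)

Section Products.
Variables (K : fieldType) (A : assocAlgType K).
Implicit Types (x y z : A).

Definition mulL x : A -> A := fun y => x ** y.
Definition mulR x : A -> A := fun y => y ** x.

Fact mulL_linear x : linear (mulL x).
Proof. by move=> c y z; rewrite /mulL assoc_mulDr assoc_scaleAr. Qed.
Fact mulR_linear x : linear (mulR x).
Proof. by move=> c y z; rewrite /mulR assoc_mulDl assoc_scaleAl. Qed.

HB.instance Definition _ x :=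
  GRing.isLinear.Build K A A _ (mulL x) (mulL_linear x).
HB.instance Definition _ x :=
  GRing.isLinear.Build K A A _ (mulR x) (mulR_linear x).

Lemma mulBl x y z : (x - y) ** z = x ** z - y ** z.
Proof. exact: (raddfB (mulR z)). Qed.
Lemma mulBr x y z : z ** (x - y) = z ** x - z ** y.
Proof. exact: (raddfB (mulL z)). Qed.
Lemma mulNl x y : (- x) ** y = - (x ** y).
Proof. exact: (raddfN (mulR y)). Qed.
Lemma mul0l x : 0 ** x = 0. Proof. exact: (raddf0 (mulR x)). Qed.
Lemma mul0r x : x ** 0 = 0. Proof. exact: (raddf0 (mulL x)). Qed.
Lemma mul_suml I (r : seq I) (P : pred I) (F : I -> A) x :
  (\sum_(i <- r | P i) F i) ** x = \sum_(i <- r | P i) F i ** x.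
Proof. exact: (raddf_sum (mulR x)). Qed.
Lemma mul_sumr I (r : seq I) (P : pred I) (F : I -> A) x :
  x ** (\sum_(i <- r | P i) F i) = \sum_(i <- r | P i) x ** F i.
Proof. exact: (raddf_sum (mulL x)). Qed.

Lemma commDr x y z : comm x (y + z) = comm x y + comm x z.
Proof. by rewrite assoc_mulDr assoc_mulDl opprD addrACA. Qed.
Lemma commMr x y z : comm x (y ** z) = comm x y ** z + y ** comm x z.
Proof. by rewrite mulBl mulBr !mulgA addrA subrK. Qed.
Lemma commMl x y z : comm (x ** y) z = x ** comm y z + comm x z ** y.
Proof. by rewrite mulBl mulBr !mulgA addrA subrK. Qed.

End Products.

Section Subspaces.
Variables (K : fieldType) (A : assocAlgType K) (V : set A).
Hypothesis subV : is_subspace V.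

Lemma subspace0 : V 0. Proof. exact: subV.1. Qed.
Lemma subspaceD x y : V x -> V y -> V (x + y).
Proof. by move=> Vx Vy; rewrite -[x]scale1r; apply: subV.2. Qed.
Lemma subspaceZ c x : V x -> V (c *: x).
Proof.
by move=> Vx; rewrite -[c *: x]addr0; apply: subV.2 => //; apply: subV.1.
Qed.
Lemma subspaceN x : V x -> V (- x).
Proof. by rewrite -scaleN1r; apply: subspaceZ. Qed.
Lemma subspaceB x y : V x -> V y -> V (x - y).
Proof. by move=> Vx /subspaceN; apply: subspaceD. Qed.
Lemma subspace_sum (I : eqType) (r : seq I) (P : pred I) (F : I -> A) :
  (forall i, i \in r -> P i -> V (F i)) -> V (\sum_(i <- r | P i) F i).
Proof.
move=> VF; rewrite big_seq_cond.
apply: big_ind; [exact: subspace0 | exact: subspaceD |].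
by move=> i /andP[]; apply: VF.
Qed.

End Subspaces.

Section Spans.
Variables (K : fieldType) (A : assocAlgType K).
Implicit Types (X Y V : set A) (s : seq A).

Lemma subspace_gen_subspace X : is_subspace (subspace_gen X).
Proof.
split=> [V [[]]//|c u v Xu Xv V [Vsub XV]].
by apply: Vsub.2; [apply: Xu | apply: Xv].
Qed.

Lemma subalgebra_gen_subalgebra X : is_subalgebra (subalgebra_gen X).
Proof.
split; first split=> [V [[[]]]//|c u v Xu Xv V [Vsub XV]].
  by apply: Vsub.1.2; [apply: Xu | apply: Xv].
by move=> u v Xu Xv V [Vsub XV]; apply: Vsub.2; [apply: Xu | apply: Xv].
Qed.

Lemma mem_gen X x : X x -> subspace_gen X x.
Proof. exact: sub_gen_smallest. Qed.

Lemma span_mem s x : x \in s -> span s x.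
Proof. by move=> xs; apply: mem_gen. Qed.

Lemma subspace_gen_sub X V : is_subspace V -> X `<=` V -> subspace_gen X `<=` V.
Proof. exact: smallest_sub. Qed.

Lemma span_sub s V : is_subspace V -> (forall x, x \in s -> V x) ->
  span s `<=` V.
Proof. exact: subspace_gen_sub. Qed.

Lemma finite_dimensionalP V :
  finite_dimensional V <-> exists s, V = span s.
Proof.
split=> [[X /finite_seqP[s ->] ->]|[s ->]]; first by exists s.
by exists [set` s] => //; apply: finite_seqP; exists s.
Qed.

Lemma span_coef s x : span s x ->
  exists c : 'I_(size s) -> K, x = \sum_i c i *: s`_i.
Proof.
move: x; apply: (@span_sub _
  [set x | exists c : 'I_(size s) -> K, x = \sum_i c i *: s`_i]).
  split=> [|c u v [d ->] [e ->]].
    by exists (fun=> 0); rewrite big1// => i _; rewrite scale0r.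
  exists (fun i => c * d i + e i).
  rewrite scaler_sumr -big_split; apply: eq_bigr => i _.
  by rewrite /= scalerA scalerDl.
move=> x /(nthP 0)[i ltis <-]; exists (fun j => (j == Ordinal ltis)%:R).
rewrite (bigD1 (Ordinal ltis)) //= eqxx scale1r big1 ?addr0// => j /negPf->.
by rewrite scale0r.
Qed.

(** The first [(size s).+1] vectors have a coefficient matrix with more rows than columns, hence a
    nonzero left kernel. The relation is packed as a polynomial so that it can later be evaluated at
    an element of the algebra. *)
Lemma span_dependent s (y : nat -> A) : (forall k, span s (y k)) ->
  exists2 q : {poly K}, q != 0 & \sum_(k < size q) q`_k *: y k = 0.
Proof.
move=> ys; have /choice[c yE] k := span_coef (ys k).
pose M : 'M[K]_((size s).+1, size s) := \matrix_(k, i) c k i.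
have /rowV0Pn[u uM u0] : kermx M != 0.
  rewrite kermx_eq0; apply/negP => /eqP rM.
  by have := rank_leq_col M; rewrite rM ltnn.
move/sub_kermxP: uM => uM.
pose q := \poly_(k < (size s).+1) u 0 (inord k).
have qE (k : 'I_(size s).+1) : q`_k = u 0 k.
  by rewrite coef_poly ltn_ord inord_val.
exists q.
  apply: contraNneq u0 => q0; apply/eqP/rowP => k.
  by rewrite -qE q0 coef0 mxE.
have -> : \sum_(k < size q) q`_k *: y k = \sum_(k < (size s).+1) q`_k *: y k.
  rewrite (big_ord_widen (size s).+1 (fun k => q`_k *: y k)) ?size_poly//.
  rewrite big_mkcond; apply: eq_bigr => k _; case: ltnP => // sk.
  by rewrite nth_default ?scale0r.
transitivity (\sum_i (u *m M) 0 i *: s`_i).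
  under eq_bigr => k _ do rewrite yE scaler_sumr.
  rewrite exchange_big; apply: eq_bigr => i _ /=.
  rewrite mxE scaler_suml; apply: eq_bigr => k _.
  by rewrite scalerA qE mxE.
by rewrite uM big1// => i _; rewrite mxE scale0r.
Qed.

(** Each of the finitely many elements of [s] is a combination of finitely many elements of [G];
    concatenating these lists gives [t]. *)
Lemma span_finite_choice (G : set A) s : span s `<=` subspace_gen G ->
  exists2 t : seq A, [set` t] `<=` G & span s `<=` span t.
Proof.
have sub1 x : subspace_gen G x ->
    exists2 t : seq A, [set` t] `<=` G & span t x.
  move: x; apply: (@subspace_gen_sub _
    [set x | exists2 t : seq A, [set` t] `<=` G & span t x]).
    split=> [|c u v [t tG tu] [t' tG' tv]].
      by exists [::] => //; apply: (subspace_gen_subspace _).1.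
    exists (t ++ t').
      by move=> x /=; rewrite mem_cat => /orP[]; [apply: tG | apply: tG'].
    apply: (subspace_gen_subspace _).2.
      apply: span_sub tu; first exact: subspace_gen_subspace.
      by move=> x xt; apply: span_mem; rewrite mem_cat xt.
    apply: span_sub tv; first exact: subspace_gen_subspace.
    by move=> x xt; apply: span_mem; rewrite mem_cat xt orbT.
  move=> x Gx; exists [:: x]; last by apply: span_mem; rewrite mem_head.
  by move=> y /=; rewrite inE => /eqP->.
move=> sG; suff [t tG st] : exists2 t : seq A, [set` t] `<=` G &
    forall x, x \in s -> span t x.
  by exists t => //; apply: span_sub => //; apply: subspace_gen_subspace.
have: forall x, x \in s -> subspace_gen G x by move=> x /span_mem; apply: sG.
elim: s {sG} => [_|x s IH sG]; first by exists [::].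
have [t tG st] := IH (fun y ys => sG y (mem_behead (s := x :: s) ys)).
have [t' tG' tx] := sub1 x (sG x (mem_head x s)).
exists (t' ++ t).
  by move=> y /=; rewrite mem_cat => /orP[]; [apply: tG' | apply: tG].
move=> y; rewrite inE => /predU1P[->|/st].
  apply: span_sub tx; first exact: subspace_gen_subspace.
  by move=> z zt; apply: span_mem; rewrite mem_cat zt.
apply: span_sub; first exact: subspace_gen_subspace.
by move=> z zt; apply: span_mem; rewrite mem_cat zt orbT.
Qed.

Lemma vandermonde_subspace V n (t : 'I_n -> K) (u : 'I_n -> A) :
  is_subspace V -> injective t ->
  (forall k, V (\sum_(j < n) t k ^+ j *: u j)) -> forall j, V (u j).
Proof.
move=> subV tinj Vt j; pose M := Vandermonde n (\row_k t k).
have Munit : M \in unitmx.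
  rewrite unitmxE det_Vandermonde unitfE.
  apply/prodf_neq0 => k _; apply/prodf_neq0 => l kl.
  rewrite !mxE subr_eq0; apply: contraTneq kl => /tinj->; by rewrite ltnn.
(* Row [j] of the inverse system recovers [u j] as a combination of the given sums. *)
have -> : u j = \sum_k invmx M k j *: \sum_(l < n) t k ^+ l *: u l.
  transitivity (\sum_l (M *m invmx M) l j *: u l).
    rewrite mulmxV// (bigD1 j)//= mxE eqxx scale1r big1 ?addr0// => l lj.
    by rewrite mxE (negPf lj) scale0r.
  under [RHS]eq_bigr => k _ do rewrite scaler_sumr.
  rewrite exchange_big; apply: eq_bigr => l _ /=.
  rewrite mxE scaler_suml; apply: eq_bigr => k _.
  by rewrite scalerA mulrC !mxE.
by apply: subspace_sum => // k _ _; apply: subspaceZ.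
Qed.

End Spans.

(** * Algebras generated by finitely many algebraic elements *)

Section Algebraic.
Variables (K : fieldType) (A : assocAlgType K).
Implicit Types (x y v : A) (p q : {poly K}).

(* [act v p x] stands for [x * p(v)], which makes sense without a unit even
   when [p] has a constant term. *)
Definition act v p x : A := \sum_(i < size p) p`_i *: iter i (mulR v) x.

Definition algebraic v : Prop := exists2 p, p != 0 & act v p v = 0.

Lemma act_wide v n p x : (size p <= n)%N ->
  act v p x = \sum_(i < n) p`_i *: iter i (mulR v) x.
Proof.
move=> pn.
rewrite /act (big_ord_widen n (fun i => p`_i *: iter i (mulR v) x))//.
rewrite big_mkcond; apply: eq_bigr => i _; case: ltnP => // ?.
by rewrite nth_default ?scale0r.
Qed.

Lemma iter_mulR_linear v n : linear (iter n (mulR v)).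
Proof. by move=> c x y; elim: n => //= n ->; rewrite linearP. Qed.

Lemma act_linear v p : linear (act v p).
Proof.
move=> c x y; rewrite /act scaler_sumr -big_split; apply: eq_bigr => i _ /=.
by rewrite iter_mulR_linear scalerDr !scalerA mulrC.
Qed.

HB.instance Definition _ v p :=
  GRing.isLinear.Build K A A _ (act v p) (act_linear v p).

Lemma actDl v p q x : act v (p + q) x = act v p x + act v q x.
Proof.
have [pn qn] := (leq_maxl (size p) (size q), leq_maxr (size p) (size q)).
rewrite (act_wide _ _ pn) (act_wide _ _ qn).
rewrite (act_wide _ _ (size_polyD p q)) -big_split; apply: eq_bigr => i _ /=.
by rewrite coefD scalerDl.
Qed.

Lemma actZl v c p x : act v (c *: p) x = c *: act v p x.
Proof.
rewrite (act_wide _ _ (size_scale_leq c p)) /act scaler_sumr.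
by apply: eq_bigr => i _; rewrite coefZ scalerA.
Qed.

Lemma act0l v x : act v 0 x = 0.
Proof. by rewrite -(scale0r 0) actZl scale0r. Qed.

Lemma act_suml v (I : Type) (r : seq I) (F : I -> {poly K}) x :
  act v (\sum_(i <- r) F i) x = \sum_(i <- r) act v (F i) x.
Proof.
by elim: r => [|i r IH]; rewrite ?big_nil ?act0l// !big_cons actDl IH.
Qed.

Lemma actXn v n x : act v 'X^n x = iter n (mulR v) x.
Proof.
rewrite /act size_polyXn (bigD1 ord_max)//= coefXn eqxx scale1r.
rewrite big1 ?addr0// => i; rewrite -val_eqE /= coefXn => /negPf->.
by rewrite scale0r.
Qed.

Lemma actM v p q x : act v (p * q) x = act v q (act v p x).
Proof.
rewrite -[q]coefK poly_def mulr_sumr !act_suml; apply: eq_bigr => j _.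
rewrite -scalerAr !actZl; congr (_ *: _).
rewrite -[p]coefK poly_def mulr_suml !act_suml raddf_sum; apply: eq_bigr => i _.
by rewrite /= -scalerAl !actZl linearZZ -exprD !actXn addnC iterD /= actXn.
Qed.

Lemma mul_act v p x y : x ** act v p y = act v p (x ** y).
Proof.
rewrite /act mul_sumr; apply: eq_bigr => i _; rewrite assoc_scaleAr.
by congr (_ *: _); elim: (i : nat) => //= n <-; rewrite /mulR mulgA.
Qed.

End Algebraic.

(** * Filtration by word length and collection of letters *)

Section WordSpans.
Variables (K : fieldType) (A : assocAlgType K) (s : seq A).
Implicit Types (x y : A) (w : seq A).

Fixpoint prods d : seq A :=
  if d is d'.+1 then s ++ [seq x ** y | x <- s, y <- prods d'] else [::].

Definition wspan d : set A := span (prods d).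

Lemma wspan_subspace d : is_subspace (wspan d).
Proof. exact: subspace_gen_subspace. Qed.
Hint Resolve wspan_subspace : core.

Lemma wspan1_span : wspan 1 = span s.
Proof.
rewrite /wspan /=; suff -> : [seq x ** y | x <- s, y <- [::]] = [::] :> seq A.
  by rewrite cats0.
by elim: (s).
Qed.

Lemma sub_wspan x d : x \in s -> wspan d.+1 x.
Proof. by move=> xs; apply: span_mem; rewrite /= mem_cat xs. Qed.

Lemma wspan_mulL x d y : x \in s -> wspan d y -> wspan d.+1 (x ** y).
Proof.
move=> xs; apply: (@span_sub _ _ _ [set y | wspan d.+1 (x ** y)]).
  split=> [|c u v xu xv]; first by rewrite /= mul0r; apply: subspace0.
  by rewrite /= assoc_mulDr assoc_scaleAr; apply: (wspan_subspace _).2.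
move=> z zd; apply: span_mem; rewrite /= mem_cat.
by apply/orP; right; apply: allpairs_f.
Qed.

Lemma wspanS d : wspan d `<=` wspan d.+1.
Proof.
elim: d => [|d IH]; apply: span_sub => // x.
rewrite /= mem_cat => /orP[|/allpairsP[[y z] /= [ys zd ->]]].
  exact: sub_wspan.
by apply: wspan_mulL ys _; apply: IH; apply: span_mem.
Qed.

Lemma wspan_le d e : (d <= e)%N -> wspan d `<=` wspan e.
Proof.
move=> /subnK<-; elim: (e - d)%N => // n IH x /IH.
by rewrite addSn; apply: wspanS.
Qed.

Lemma wspan_mul d e x y : wspan d x -> wspan e y -> wspan (d + e) (x ** y).
Proof.
move=> dx ey; move: x dx.
apply: (@span_sub _ _ _ [set x | wspan (d + e) (x ** y)]).
  split=> [|c u v xu xv]; first by rewrite /= mul0l; apply: subspace0.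
  by rewrite /= assoc_mulDl assoc_scaleAl; apply: (wspan_subspace _).2.
elim: d => //= d IH x; rewrite mem_cat => /orP[xs|].
  by apply: wspan_le (wspan_mulL xs ey); rewrite addSn ltnS leq_addl.
case/allpairsP=> [[u v] /= [us vd ->]].
by rewrite addSn -mulgA; apply: wspan_mulL us (IH _ vd).
Qed.

Lemma span_wspan x : span s x -> wspan 1 x.
Proof. by rewrite wspan1_span. Qed.

Lemma wspan_subalgebra_gen (X : set A) : [set` s] `<=` subalgebra_gen X ->
  forall d, wspan d `<=` subalgebra_gen X.
Proof.
move=> sX d; have subX := subalgebra_gen_subalgebra X.
apply: span_sub; first exact: subX.1.
elim: d => //= d IH x; rewrite mem_cat => /orP[/sX//|].
by case/allpairsP=> [[u v] /= [us vd ->]]; apply: subX.2; [apply: sX|apply: IH].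
Qed.

Section Lie.
Hypothesis s_lie : {in s &, forall x y, span s (comm x y)}.
Hypothesis s_alg : {in s, forall x, algebraic x}.

(* Words keep their last letter [y] apart, as there is no empty product. *)
Definition wprod w y : A := foldr (@mulL K A) y w.

Lemma wprod_wspan w y d : all [in s] w -> wspan d y ->
  wspan (size w + d) (wprod w y).
Proof.
elim: w => //= x w IH /andP[xs ws] yd.
by rewrite addSn; apply: wspan_mulL xs (IH ws yd).
Qed.

(** Moving [x] left past a letter [z] costs a commutator of [z] and [x], which lies in [span s] and
    so counts as one letter instead of two. The error is thus one letter shorter than the product,
    whose length includes [y]. *)
Lemma wprod_front w1 w2 x y :
  all [in s] w1 -> all [in s] w2 -> x \in s -> y \in s ->
  wspan (size w1 + size w2).+1
    (wprod (w1 ++ x :: w2) y - wprod (x :: w1 ++ w2) y).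
Proof.
move=> w1s w2s xs ys; elim: w1 w1s => [_|z w1 IH /= /andP[zs w1s]].
  by rewrite subrr; apply: subspace0.
rewrite -[_ - _](subrKA (z ** (x ** wprod (w1 ++ w2) y))).
apply: (subspaceD (wspan_subspace _)).
  by rewrite /mulL -mulBr addSn; apply: wspan_mulL zs (IH w1s).
rewrite /mulL !mulgA -mulBl addSn -addn1 addnC.
apply: wspan_mul; first by exact: (span_wspan (s_lie zs xs)).
rewrite -size_cat -addn1; apply: wprod_wspan; first by rewrite all_cat w1s.
exact: sub_wspan.
Qed.

Lemma wprod_gather n x w y : x \in s -> y \in s -> all [in s] w ->
  (n <= count_mem x w)%N ->
  exists w', [/\ (n + size w' = size w)%N, all [in s] w' &
    wspan (size w) (wprod w y - wprod (nseq n x ++ w') y)].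
Proof.
move=> xs ys; elim: n w => [|n IH] w ws nx.
  by exists w; split=> //; rewrite subrr; apply: subspace0.
have xw : x \in w by rewrite -has_pred1 has_count (leq_trans _ nx).
case/splitPr: xw ws nx => w1 w2.
rewrite all_cat count_cat => /= /and3P[w1s _ w2s].
rewrite eqxx add1n addnS ltnS => nx.
have w12s : all [in s] (w1 ++ w2) by rewrite all_cat w1s.
have [|w' [sw' w's ww']] := IH _ w12s; first by rewrite count_cat.
have sizeE : size (w1 ++ x :: w2) = (size (w1 ++ w2)).+1.
  by rewrite !size_cat /= addnS.
exists w'; split=> //; first by rewrite sizeE addSn sw'.
rewrite -[_ - _](subrKA (wprod (x :: w1 ++ w2) y)) sizeE.
apply: (subspaceD (wspan_subspace _)).
  by rewrite size_cat; apply: wprod_front.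
by rewrite /= /mulL -mulBr; apply: wspan_mulL.
Qed.

Lemma iter_mulL_wprod n x y : iter n (mulL x) y = wprod (nseq n x) y.
Proof. by elim: n => //= n ->. Qed.

Lemma iter_mulLR n x : iter n (mulL x) x = iter n (mulR x) x.
Proof.
elim: n => //= n ->; elim: n => //= n IH.
by rewrite -[in RHS]IH /mulL /mulR mulgA.
Qed.

Lemma algebraic_power x : x \in s ->
  exists n, forall m, (n <= m)%N -> wspan m (iter m (mulR x) x).
Proof.
move=> xs; have [p p0 pv] := s_alg xs.
have iter_wspan m : wspan m.+1 (iter m (mulR x) x).
  rewrite -iter_mulLR iter_mulL_wprod -addn1 -[X in (X + _)%N](size_nseq m x).
  by apply: wprod_wspan; rewrite ?all_nseq ?xs ?orbT//; apply: sub_wspan.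
(* Since [iter m (mulR x) x] is the power of exponent [m.+1], the relation [act x p x = 0] rewrites
   the power of exponent [size p] by lower ones, which saves one letter. If [p] is constant, then
   [x] is 0 and [wspan 0] is the zero space. *)
exists (size p).-1; suff pred : wspan (size p).-1 (iter (size p).-1 (mulR x) x).
  move=> m /subnK<-; elim: (m - _)%N => // k IH.
  by rewrite addSn /= -addn1; apply: wspan_mul IH _; apply: sub_wspan.
move: pv; rewrite /act; have sp := polySpred p0; rewrite sp big_ord_recr /=.
rewrite -lead_coefE => /eqP; rewrite addrC addr_eq0 => /eqP top.
rewrite -[X in wspan _ X]scale1r -(mulVf (x := lead_coef p)) ?lead_coef_eq0//.
rewrite -scalerA top; apply: (subspaceZ (wspan_subspace _)).
apply: (subspaceN (wspan_subspace _)).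
apply: (subspace_sum (wspan_subspace _)) => i _ _.
apply: (subspaceZ (wspan_subspace _)).
exact: wspan_le (iter_wspan i).
Qed.

Lemma size_count_all w : all [in s] w ->
  (size w <= \sum_(x <- s) count_mem x w)%N.
Proof.
elim: w => //= x w IH /andP[xs ws].
rewrite big_split /= -add1n leq_add ?IH//.
by rewrite (big_rem x) //= eqxx.
Qed.

(* Beyond some length a word contains some letter so often that, once gathered
   in front, its power has a shorter expression. *)
Lemma wspan_stable : exists d, forall e, wspan e `<=` wspan d.+1.
Proof.
have [N NP] : exists N, {in s, forall x, forall m, (N <= m)%N ->
    wspan m (iter m (mulR x) x)}.
  have: {in s, forall x, exists n, forall m, (n <= m)%N ->
    wspan m (iter m (mulR x) x)} by move=> x /algebraic_power.
  move: wspan => W; elim: (s) => [_|x r IH rP]; first by exists 0%N.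
  have [N NP] := IH (fun y yr => rP y (mem_behead (s := x :: r) yr)).
  have [n nP] := rP x (mem_head x r).
  exists (maxn N n) => y; rewrite inE => /predU1P[->|yr] m; rewrite geq_max.
    by case/andP=> _; apply: nP.
  by case/andP=> + _; apply: NP.
(* By pigeonhole, a word of more than [N * size s] letters repeats some letter more than [N]
   times. *)
pose D := (N * size s)%N.
have wprod_short w y : all [in s] w -> y \in s -> (D < size w)%N ->
    wspan (size w) (wprod w y).
  move=> ws ys Dw.
  have [x xs Nx] : exists2 x, x \in s & (N < count_mem x w)%N.
    apply/hasP; apply: contraTT Dw; rewrite -all_predC -leqNgt => /allP sN.
    apply: leq_trans (size_count_all ws) _; rewrite /D.
    elim: (s) sN => [|x r IH] sN; first by rewrite big_nil.
    rewrite big_cons mulnS leq_add//.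
      by rewrite leqNgt; apply: sN (mem_head x r).
    by apply: IH => z zr; apply: sN; rewrite inE zr orbT.
  have [w' [sw w's ww']] := wprod_gather xs ys ws Nx.
  rewrite -[wprod w y](subrK (wprod (nseq N.+1 x ++ w') y)).
  apply: (subspaceD (wspan_subspace _) ww').
  (* The [N.+1] gathered copies form [iter N (mulR x) x], which [NP] places in [wspan N]: one letter
     is saved. *)
  have -> : wprod (nseq N.+1 x ++ w') y = iter N (mulR x) x ** wprod w' y.
    rewrite /wprod foldr_cat -/(wprod w' y).
    rewrite -[LHS]/(wprod (nseq N.+1 x) (wprod w' y)).
    rewrite -iter_mulL_wprod -iter_mulLR; elim: (N) => //= n IHn.
    by rewrite IHn /mulL mulgA.
  rewrite -sw addSnnS; apply: wspan_mul; first exact: NP.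
  by rewrite -addn1; apply: wprod_wspan => //; apply: sub_wspan.
have prodsP e x : x \in prods e ->
    exists w y, [/\ x = wprod w y, all [in s] w, y \in s & (size w < e)%N].
  elim: e x => //= e IH x; rewrite mem_cat => /orP[xs|].
    by exists [::], x.
  case/allpairsP=> [[u v] /= [us /IH[w [y [-> ws ys we]]] ->]].
  by exists (u :: w), y; rewrite /= us ws.
exists D; elim=> [|e IH]; first exact: wspan_le.
apply: span_sub => // x /prodsP[w [y [-> ws ys]]]; rewrite ltnS => we.
have [wD|Dw] := leqP (size w) D; last first.
  by apply: IH; apply: wspan_le we _ _; apply: wprod_short.
apply: (@wspan_le (size w + 1)); first by rewrite addn1.
by apply: wprod_wspan => //; apply: sub_wspan.
Qed.

End Lie.
End WordSpans.

(** Finitely many algebraic elements of [V] already span [V], so their commutators stay in their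
    span and [wspan_stable] applies. The stable term of the filtration is closed under products and
    is the whole subalgebra. *)
Lemma finite_dimensional_subalgebra_gen (K : fieldType) (A : assocAlgType K)
    (X : set A) (V := subspace_gen X) :
  finite_dimensional V -> (forall x y, V x -> V y -> V (comm x y)) ->
  X `<=` subspace_gen (V `&` @algebraic K A) ->
  finite_dimensional (subalgebra_gen X).
Proof.
move=> /finite_dimensionalP[s Vs] V_lie XG.
have subV : is_subspace V by apply: subspace_gen_subspace.
have VG : span s `<=` subspace_gen (V `&` @algebraic K A).
  rewrite -Vs; apply: subspace_gen_sub XG; exact: subspace_gen_subspace.
have [t tG st] := span_finite_choice VG.
have Vt : V = span t.
  apply/seteqP; split; first by rewrite Vs.
  by apply: span_sub => // x xt; have [] := tG x xt.
have [||d dP] := @wspan_stable _ _ t.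
- move=> x y xt yt; rewrite -Vt.
  by apply: V_lie; rewrite Vt; apply: span_mem.
- by move=> x xt; have [] := tG x xt.
apply/finite_dimensionalP; exists (prods t d.+1); apply/seteqP; split.
  apply: smallest_sub.
    split=> [|u v ud vd]; first exact: wspan_subspace.
    by apply: (dP (d.+1 + d.+1)%N); apply: wspan_mul.
  move=> x Xx; apply: (@wspan_le _ _ _ 1) => //.
  by apply: span_wspan; rewrite -Vt; apply: mem_gen.
apply: wspan_subalgebra_gen => x /tG[Vx _].
apply: subspace_gen_sub Vx; first exact: (subalgebra_gen_subalgebra X).1.
exact: sub_gen_smallest.
Qed.

(** * Algebraic elements in Lie ideals *)

Section Ideals.
Variables (K : fieldType) (A : assocAlgType K).
Implicit Types (I J V : set A) (x y z a b : A).

Definition is_ideal I : Prop :=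
  is_subspace I /\ forall a x, I x -> I (a ** x) /\ I (x ** a).

Definition ideal_gen (X : set A) : set A := smallest is_ideal X.

Lemma ideal_gen_ideal X : is_ideal (ideal_gen X).
Proof.
split; first split=> [I [[[]]]//|c u v Xu Xv I [Iid XI]].
  by apply: Iid.1.2; [apply: Xu | apply: Xv].
move=> a x Xx; split=> I [Iid XI].
  by apply: (Iid.2 a x _).1; apply: Xx.
by apply: (Iid.2 a x _).2; apply: Xx.
Qed.

Lemma ideal_trans I x y z : is_ideal I -> I (x - y) -> I (y - z) -> I (x - z).
Proof. by move=> [subI _] Ixy Iyz; rewrite -(subrKA y); apply: subspaceD. Qed.

Lemma ideal_cong0 I x x' y y' : is_ideal I ->
  I (x - x') -> I (y - y') -> I (x' ** y') -> I (x ** y).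
Proof.
move=> Iid Ix Iy Ixy.
rewrite -(subrK (x' ** y') (x ** y)); apply: (subspaceD Iid.1) Ixy.
apply: (ideal_trans Iid (y := x' ** y)).
  by rewrite -mulBl; apply: (Iid.2 _ _ _).2.
by rewrite -mulBr; apply: (Iid.2 _ _ _).1.
Qed.

Lemma ideal_mul_iter I z n x y : is_ideal I -> (forall a, I (comm z a)) ->
  I (x ** iter n (mulL z) y - iter n (mulL z) (x ** y)).
Proof.
move=> Iid Iz; elim: n => [|n IH] /=; first by rewrite subrr; apply: Iid.1.1.
rewrite /mulL mulgA.
apply: (ideal_trans Iid (y := z ** x ** iter n (mulL z) y)).
  rewrite -mulBl -opprB mulNl; apply: (subspaceN Iid.1).
  by apply: (Iid.2 _ _ _).2.
by rewrite -mulgA -mulBr; apply: (Iid.2 _ _ _).1.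
Qed.

Lemma ideal_iter I z n x y : is_ideal I -> I (x - y) ->
  I (iter n (mulL z) x - iter n (mulL z) y).
Proof.
move=> Iid Ixy; elim: n => //= n IH.
by rewrite /mulL -mulBr; apply: (Iid.2 _ _ _).1.
Qed.

End Ideals.

Section LieIdeal.
Variables (K : fieldType) (A : assocAlgType K) (s : seq A).
Implicit Types (u v x y a b : A).
Let V := span s.
Hypothesis V_lie : forall v a, V v -> V (comm v a).

Let L := wspan s 2.
Let subL : is_subspace L. Proof. exact: wspan_subspace. Qed.
Let subV : is_subspace V. Proof. exact: subspace_gen_subspace. Qed.

Let L_V v : V v -> L v.
Proof. by move=> /span_wspan Vv; apply: wspanS. Qed.

Let L_VV u v : V u -> V v -> L (u ** v).
Proof. by move=> Vu Vv; apply: (@wspan_mul _ _ _ 1 1); apply: span_wspan. Qed.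

Let V_lieC v a : V v -> V (comm a v).
Proof. by move=> Vv; rewrite -opprB; apply: subspaceN (V_lie _ _). Qed.

Let L_comm x a : L x -> L (comm a x).
Proof.
move: x; rewrite {1}/L /wspan; apply: (@span_sub _ _ _ [set x | L (comm a x)]).
  split=> [|c u v Lu Lv]; first by rewrite /= mul0l mul0r subrr; apply: subL.1.
  rewrite /= assoc_mulDl assoc_mulDr assoc_scaleAl assoc_scaleAr.
  by rewrite opprD addrACA -scalerBr; apply: subL.2.
move=> x; rewrite /= mem_cat => /orP[/span_mem xs|].
  by apply: L_V; apply: V_lieC.
case/allpairsP=> [[u v] /= [/span_mem us vs ->]].
have {}vs : V v by rewrite /V -wspan1_span; apply: span_mem.
by rewrite commMr; apply: (subspaceD subL); apply: L_VV => //; apply: V_lieC.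
Qed.

(* The largest ideal inside [V + V^2]; it contains [[V, V]] because
   [u, v] a = [u, v a] - v [u, a]. *)
Let I : set A := [set x | [/\ L x, forall a, L (x ** a), forall a, L (a ** x)
  & forall a b, L (a ** x ** b)]].

Let I_ideal : is_ideal I.
Proof.
split; first split.
- split=> [|a|a|a b]; rewrite ?mul0l ?mul0r ?mul0l; exact: subL.1.
- move=> c u v [u1 u2 u3 u4] [v1 v2 v3 v4]; split=> [|a|a|a b];
  rewrite ?(assoc_mulDl, assoc_mulDr, assoc_scaleAl, assoc_scaleAr);
  exact: subL.2.
- move=> a x [x1 x2 x3 x4]; split; split=> [|b|b|b c] //;
  rewrite ?mulgA //; by rewrite -[_ ** a ** _]mulgA.
Qed.

Let I_comm u v : V u -> V v -> I (comm u v).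
Proof.
move=> Vu Vv.
have LR a : L (comm u v ** a).
  have -> : comm u v ** a = comm u (v ** a) - v ** comm u a.
    by rewrite commMr addrK.
  by apply: (subspaceB subL); [apply: L_V | apply: L_VV => //]; apply: V_lie.
split=> // [|a|a b]; first by apply: L_V; apply: V_lie.
  (* Left multiples reduce to right ones because [L] is stable under commutators with any element of
     [A]. *)
  have -> : a ** comm u v = comm a (comm u v) + comm u v ** a by rewrite subrK.
  by apply: (subspaceD subL) => //; apply: L_comm; apply: L_V; apply: V_lie.
have -> : a ** comm u v ** b = comm a (comm u v ** b) + comm u v ** (b ** a).
  by rewrite !mulgA subrK.
by apply: (subspaceD subL) => //; apply: L_comm.
Qed.

Section Square.
Variable v : A.
Hypothesis Vv : V v.
(* The square of [v] is central modulo [I] in characteristic 2, which is why it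
   is used rather than [v]. *)
Let z := v ** v.

Let I_comm2 a : I (comm v (comm v a)).
Proof. by apply: I_comm => //; apply: V_lie. Qed.

(* [v,[v,ab]] = [v,[v,a]]b + 2[v,a][v,b] + a[v,[v,b]]. *)
Let I_2 a b : I (comm v a ** comm v b + comm v a ** comm v b).
Proof.
have := I_comm2 (a ** b); rewrite commMr.
rewrite commDr (commMr v (comm v a)) (commMr v a).
set p := comm v a ** comm v b; set q := comm v (comm v a) ** b.
set r := a ** comm v (comm v b) => Iqr.
have -> : p + p = q + p + (p + r) - (q + r).
  by rewrite [q + p]addrC addrACA addrK.
apply: (subspaceB I_ideal.1) => //.
apply: (subspaceD I_ideal.1); first exact: (I_ideal.2 b _ (I_comm2 a)).2.
exact: (I_ideal.2 a _ (I_comm2 b)).1.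
Qed.

(** Modulo [I], [v] commutes with [d] and [e], so [comm z a] and [comm z b] become [v ** (d + d)]
    and [(e + e) ** v]. Their product contains [d ** e] four times between two factors [v], and
    [I_2] absorbs these in pairs. *)
Let I_zz a b : I (comm z a ** comm z b).
Proof.
rewrite /z (commMl v v a) (commMl v v b); set d := comm v a; set e := comm v b.
apply: (@ideal_cong0 _ _ _ _ (v ** (d + d)) _ ((e + e) ** v) I_ideal).
- rewrite (assoc_mulDr v d d) opprD addrACA subrr add0r.
  by rewrite -[X in I X]opprB; apply: (subspaceN I_ideal.1 (I_comm2 a)).
- rewrite (assoc_mulDl e e v) opprD [v ** e + _]addrC addrACA subrr add0r.
  exact: I_comm2.
- rewrite mulgA -(mulgA v).
  apply: (I_ideal.2 _ _ _).2; apply: (I_ideal.2 _ _ _).1.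
  rewrite (assoc_mulDl d d) (assoc_mulDr d e e).
  by apply: (subspaceD I_ideal.1); apply: I_2.
Qed.

Let J := ideal_gen (range (fun a => comm z a)).

Let J_ideal : is_ideal J. Proof. exact: ideal_gen_ideal. Qed.

(** The claim is strengthened by an arbitrary middle factor [c], which makes the set of such [x]
    stable under right multiplication. *)
Let J_z x b : J x -> I (x ** comm z b).
Proof.
move=> Jx; suff [] : [set x | (forall b, I (x ** comm z b)) /\
  (forall c b, I (x ** c ** comm z b))] x by [].
apply: smallest_sub Jx => [|_ [a _ <-]]; last first.
  split=> [b'|c b']; first exact: I_zz.
  rewrite -mulgA.
  (* The derivation rule moves [c] inside the commutator, leaving only products covered by
     [I_zz]. *)
  have -> : c ** comm z b' = comm z (c ** b') - comm z c ** b'.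
    by rewrite (commMr z c) [RHS]addrC addKr.
  rewrite mulBr (mulgA _ (comm z c)).
  apply: (subspaceB I_ideal.1); first exact: I_zz.
  exact: (I_ideal.2 b' _ (I_zz a c)).2.
split; first split.
- by split=> [c|c d]; rewrite !mul0l; apply: I_ideal.1.1.
- move=> c x1 x2 [x11 x12] [x21 x22].
  by split=> *; rewrite !(assoc_mulDl, assoc_scaleAl); apply: I_ideal.1.2.
- move=> a x1 [x11 x12]; split; split=> [d|c d] //.
  + by rewrite -(mulgA a x1); apply: (I_ideal.2 _ _ _).1.
  + rewrite -(mulgA a x1) -(mulgA a (x1 ** c)).
    by apply: (I_ideal.2 _ _ _).1.
  + by rewrite -(mulgA x1).
Qed.

Let J_square x : J x -> I (x ** x).
Proof.
suff JJ y : J y -> forall x, J x -> I (x ** y) by move=> Jx; apply: JJ.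
move: y; apply: smallest_sub => [|_ [a _ <-] y /J_z//].
split; first split=> [y _|c y1 y2 Jy1 Jy2 y Jy].
- by rewrite mul0r; apply: I_ideal.1.1.
- rewrite assoc_mulDr assoc_scaleAr.
  by apply: I_ideal.1.2; [apply: Jy1 | apply: Jy2].
- move=> a y Jy; split=> w Jw; rewrite mulgA.
    by apply: Jy; apply: (J_ideal.2 _ _ _).2.
  by apply: (I_ideal.2 _ _ _).2; apply: Jy.
Qed.

(** Here [y k] stands for the value obtained by multiplying one argument by the [k]-th power of [z].
    It stays in [V] and agrees with [iter (k * j) (mulL z) v] modulo every ideal that makes [z]
    central, in particular modulo [J]. *)
Lemma lie_ideal_algebraic j (y : nat -> A) : (0 < j)%N -> (forall k, V (y k)) ->
  (forall k J, is_ideal J -> (forall a, J (comm z a)) ->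
     J (y k - iter (k * j) (mulL z) v)) ->
  algebraic v.
Proof.
move=> j0 Vy Jy; have [q q0 qy] := span_dependent Vy.
(* As [z] is [v ** v], multiplying by [z] [k * j] times raises the exponent of [v] by [2 * k * j];
   hence the substitution of ['X^(j.*2)], which keeps [q] nonzero because [j] is positive. *)
pose p := q \Po 'X^(j.*2); pose w := act v p v.
have p0 : p != 0.
  by rewrite comp_poly_eq0 // size_polyXn ltnS double_gt0.
have wE : w = \sum_(k < size q) q`_k *: iter (k * j) (mulL z) v.
  rewrite /w /p comp_polyE act_suml; apply: eq_bigr => k _.
  rewrite actZl -exprM actXn; congr (_ *: _).
  rewrite -iter_mulLR -doubleMl mulnC; elim: (k * j)%N => // n IHn.
  by rewrite doubleS !iterS IHn /mulL mulgA.
have Jw : J w.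
  have -> : w = - \sum_(k < size q) q`_k *: (y k - iter (k * j) (mulL z) v).
    under eq_bigr do rewrite scalerBr.
    by rewrite sumrB qy -wE sub0r opprK.
  apply: (subspaceN J_ideal.1); apply: (subspace_sum J_ideal.1) => k _ _.
  apply: (subspaceZ J_ideal.1).
  by apply: (Jy k J J_ideal) => a; apply: sub_gen_smallest; exists a.
(* With [w = act v p v], the product [w ** w] equals [act v p1 v]; the factor ['X] accounts for the
   second [v]. *)
pose p1 := p * ('X * p).
have Iw : I (act v p1 v).
  rewrite !actM -['X]expr1 actXn /= /mulR -/w.
  have := J_square Jw; rewrite {2}/w mul_act; exact.
have Lw k : L (iter k (mulR v) (act v p1 v)).
  suff [] : I (iter k (mulR v) (act v p1 v)) by [].
  by elim: k => //= k /(I_ideal.2 v)[].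
(* The multiples of [w ** w] by powers of [v] stay in [I], hence in the finite-dimensional [L]; a
   second linear dependence makes [v] algebraic. *)
have [q' q'0 q'w] := span_dependent Lw.
exists (p1 * q'); last by rewrite actM /act q'w.
by rewrite !mulf_neq0 // polyX_eq0.
Qed.

End Square.
End LieIdeal.

(** * Values of polynomials *)

Section Words.
Variables (K : fieldType) (A : assocAlgType K).
Implicit Types (a : nat -> A) (b c x y z : A) (i l j n : nat) (r w : seq nat).

(* Words are read backwards, to match the left fold in [eval_mon]. *)
Fixpoint evr a r : A :=
  match r with
  | [::] => 0
  | [:: l] => a l
  | l :: r' => evr a r' ** a l
  end.

Lemma evr_cons a l r : r != [::] -> evr a (l :: r) = evr a r ** a l.
Proof. by case: r. Qed.

Lemma eval_mon_evr a (w : {fmonom nat}) : eval_mon a w = evr a (rev w).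
Proof.
rewrite /eval_mon; case: (w : seq nat) => {w} [|i w] //.
elim/last_ind: w => [|w l IH] //.
rewrite -rcons_cons rev_rcons evr_cons ?foldl_rcons ?IH//.
by rewrite rev_cons; case: (rev w).
Qed.

Lemma word_ind (P : seq nat -> Prop) : (forall l, P [:: l]) ->
  (forall l r, r != [::] -> P r -> P (l :: r)) -> forall r, r != [::] -> P r.
Proof.
move=> P1 PS; elim=> // l [|l' r] IH _; first exact: P1.
by apply: PS => //; apply: IH.
Qed.

Definition upd a i x : nat -> A := fun l => if l == i then x else a l.

(* The coefficient of [t^j] in the value of [r] at [a i + t b] in place of
   [a i]. *)
Fixpoint coefr i b a r j : A :=
  match r with
  | [::] => 0
  | [:: l] => if j is 0 then a l else if (j == 1%N) && (l == i) then b else 0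
  | l :: r' => coefr i b a r' j ** a l +
      (if (l == i) && (0 < j)%N then coefr i b a r' j.-1 ** b else 0)
  end.

Lemma coefr_cons i b a l r j : r != [::] ->
  coefr i b a (l :: r) j = coefr i b a r j ** a l +
    (if (l == i) && (0 < j)%N then coefr i b a r j.-1 ** b else 0).
Proof. by case: r. Qed.

Lemma coefr0 i b a r : coefr i b a r 0 = evr a r.
Proof.
have [->//|] := eqVneq r [::]; move: r.
apply: word_ind => // l r r0 IH.
by rewrite coefr_cons// evr_cons// IH andbF addr0.
Qed.

Lemma coefr_gt i b a r j : (count_mem i r < j)%N -> coefr i b a r j = 0.
Proof.
have [->//|r0] := eqVneq r [::]; move: r r0 j.
apply: word_ind => [l|l r r0 IH] j.
  by rewrite /= addn0; case: j => // j; case: (l == i) => //; case: j.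
rewrite coefr_cons//=; case: (l == i) => /= j_gt; last first.
  by rewrite IH// mul0l addr0.
rewrite IH ?mul0l ?add0r; last exact: leq_ltn_trans (leq_addl _ _) j_gt.
by case: j j_gt => // j; rewrite add1n ltnS => /IH /= ->; rewrite mul0l.
Qed.

(** The highest power of [t] arises only when every occurrence of the letter [i] contributes [b]. *)
Lemma coefr_top i b a r : coefr i b a r (count_mem i r) = evr (upd a i b) r.
Proof.
have [->//|] := eqVneq r [::]; move: r.
apply: word_ind => [l|l r r0 IH]; first by rewrite /= /upd; case: (l == i).
rewrite coefr_cons// evr_cons// -IH /= /upd; case: (l == i) => /=.
  by rewrite add1n /= coefr_gt// mul0l add0r.
by rewrite add0n addr0.
Qed.

Lemma evr_upd_add i b a r n (t : K) : (count_mem i r < n)%N ->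
  evr (upd a i (a i + t *: b)) r = \sum_(j < n) t ^+ j *: coefr i b a r j.
Proof.
have [-> _|r0] := eqVneq r [::].
  by rewrite big1// => j _; rewrite scaler0.
move: r r0 n; apply: word_ind => [l|l r r0 IH] n.
  rewrite /= addn0 /upd; have [->|li] := eqVneq l i.
    case: n => [|[|n]] // _; rewrite !big_ord_recl big1 ?addr0 => [|j _] /=.
      by rewrite expr0 expr1 scale1r.
    by rewrite scaler0.
  case: n => // n _; rewrite big_ord_recl big1 ?addr0 ?expr0 ?scale1r// => j _.
  by rewrite /= andbF scaler0.
rewrite evr_cons// [count_mem i (l :: r)]/= /upd.
have [->|li] := eqVneq l i; last first.
  rewrite add0n => rn; rewrite (IH n)// mul_suml; apply: eq_bigr => j _.
  by rewrite assoc_scaleAl coefr_cons// (negPf li) addr0.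
case: n => // n; rewrite add1n ltnS => rn.
rewrite assoc_mulDr assoc_scaleAr {1}(IH n.+1) ?leqW// (IH n)//.
under [RHS]eq_bigr do rewrite coefr_cons// eqxx scalerDr.
rewrite big_split /= mul_suml; congr (_ + _).
  by apply: eq_bigr => j _; rewrite assoc_scaleAl.
(* Choosing [b] at the last letter raises the power of [t] by one, so the index shifts and the term
   at 0 vanishes. *)
rewrite big_ord_recl /= scaler0 add0r mul_suml scaler_sumr.
by apply: eq_bigr => j _; rewrite /= assoc_scaleAl scalerA -exprS.
Qed.

Lemma evr_upd_scale i a r (t : K) :
  evr (upd a i (t *: a i)) r = t ^+ count_mem i r *: evr a r.
Proof.
have [->|] := eqVneq r [::]; first by rewrite scaler0.
move: r; apply: word_ind => [l|l r r0 IH].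
  rewrite /= /upd; have [->|li] := eqVneq l i; first by rewrite expr1.
  by rewrite expr0 scale1r.
rewrite !evr_cons// IH /= /upd; have [->|li] := eqVneq l i.
  by rewrite assoc_scaleAl assoc_scaleAr scalerA exprD expr1 mulrC.
by rewrite add0n assoc_scaleAl.
Qed.

(** This is the Leibniz rule for the derivation [comm _ c]: the coefficient of [t] replaces one
    occurrence of a letter at a time by its commutator with [c]. *)
Lemma sum_coefr1_comm (s : seq nat) a c r : uniq s -> {subset r <= s} ->
  \sum_(i <- s) coefr i (comm (a i) c) a r 1 = comm (evr a r) c.
Proof.
move=> us; have [-> _|r0] := eqVneq r [::].
  by rewrite big1//= mul0l mul0r subrr.
move: r r0; apply: word_ind => [l ls|l r r0 IH rs].
  rewrite (bigD1_seq l) ?ls ?mem_head//= eqxx big1 ?addr0// => i.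
  by rewrite eq_sym => /negPf->.
rewrite evr_cons// (commMl (evr a r)).
under eq_bigr do rewrite coefr_cons// andbT coefr0.
rewrite big_split /= -mul_suml IH; last first.
  by move=> i ir; apply: rs; rewrite inE ir orbT.
rewrite (bigD1_seq l) ?rs ?mem_head//= eqxx big1 ?addr0; last first.
  by move=> i; rewrite eq_sym => /negPf->.
by rewrite addrC.
Qed.

(** Modulo [J] the element [z] is central, so the factors [z] attached to all occurrences of the
    letter [i] can be collected in front. *)
Lemma evr_upd_iter (J : set A) z i a r n : is_ideal J ->
  (forall x, J (comm z x)) ->
  J (evr (upd a i (iter n (mulL z) (a i))) r -
     iter (n * count_mem i r) (mulL z) (evr a r)).
Proof.
move=> Jid Jz; have J0 x : J (x - x) by rewrite subrr; apply: Jid.1.1.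
have [->|] := eqVneq r [::].
  by rewrite muln0; apply: J0.
move: r; apply: word_ind => [l|l r r0 IH].
  rewrite /= /upd; have [->|li] := eqVneq l i; first by rewrite muln1.
  by rewrite muln0; apply: J0.
set m := (n * count_mem i r)%N in IH.
have iterM k x y : iter k (mulL z) x ** y = iter k (mulL z) (x ** y).
  by elim: k => //= k IHk; rewrite /mulL -mulgA IHk.
rewrite !evr_cons//= /upd; set x := (if _ then _ else _).
apply: (ideal_trans Jid (y := iter m (mulL z) (evr a r) ** x)).
  by rewrite -mulBl; apply: (Jid.2 _ _ _).2.
rewrite iterM /x; have [->|li] := eqVneq l i; last by rewrite add0n.
rewrite mulnDr muln1 addnC iterD; apply: ideal_iter => //.
exact: ideal_mul_iter.
Qed.

End Words.

(** * Homogeneous components of a polynomial and their values *)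

Section Values.
Variables (K : fieldType) (A : assocAlgType K) (f : {free K}).
Implicit Types (s : seq A) (P : pred {fmonom nat}) (a : nat -> A) (b c : A).
Implicit Types (V : set A).

(** Selecting monomials by a predicate gives the values of the components of [f] without forming
    them as polynomials. *)
Definition evalP P a : A := \sum_(w <- msupp f | P w) f@_w *: evr a (rev w).

Lemma evalP_predT a : evalP xpredT a = eval f a.
Proof. by rewrite /eval; apply: eq_bigr => w _; rewrite eval_mon_evr. Qed.

Lemma mem_vars w i : w \in msupp f -> i \in (w : seq nat) -> i \in vars f.
Proof.
move=> wf iw; rewrite /vars mem_undup; apply/flattenP; exists (w : seq nat) => //.
by apply/mapP; exists w.
Qed.

Lemma deg_mon_max w i : w \in msupp f -> (deg_mon i w <= max_deg f)%N.
Proof.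
move=> wf; have [iw|niw] := boolP (i \in (w : seq nat)); last first.
  by rewrite /deg_mon (count_memPn niw).
apply: leq_trans (leq_bigmax_seq i _ _) => //; last exact: mem_vars iw.
exact: (leq_bigmax_seq w).
Qed.

(** Replacing [a i] by [t *: a i] multiplies the part of degree [j] in that variable by [t ^+ j]; a
    Vandermonde system isolates each part. *)
Lemma evalP_split_deg V n (t : 'I_n -> K) P i : is_subspace V -> injective t ->
  (forall w, w \in msupp f -> (deg_mon i w < n)%N) ->
  (forall a, V (evalP P a)) ->
  forall (j : 'I_n) a, V (evalP (fun w => P w && (deg_mon i w == j)) a).
Proof.
move=> subV tinj fn PV j a.
apply: (vandermonde_subspace
  (u := fun j : 'I_n => evalP (fun w => P w && (deg_mon i w == j)) a) subV tinj).
move=> k; have := PV (upd a i (t k *: a i)); congr V.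
under [RHS]eq_bigr => l _ do rewrite /evalP scaler_sumr big_mkcondr.
rewrite exchange_big /= /evalP big_seq_cond [RHS]big_seq_cond.
apply: eq_bigr => w /andP[wf _].
rewrite (bigD1 (Ordinal (fn w wf)))//= eqxx big1 ?addr0.
  by rewrite evr_upd_scale count_rev scalerA mulrC -scalerA.
by move=> l; rewrite -val_eqE eq_sym /= => /negPf->.
Qed.

Lemma values_lie_ideal V : is_subspace V ->
  (forall i a b, i \in vars f ->
     V (\sum_(w <- msupp f) f@_w *: coefr i b a (rev w) 1)) ->
  forall a c, V (comm (eval f a) c).
Proof.
move=> subV V1 a c; rewrite -evalP_predT /evalP.
have -> : comm (\sum_(w <- msupp f) f@_w *: evr a (rev w)) c =
    \sum_(i <- vars f)
      \sum_(w <- msupp f) f@_w *: coefr i (comm (a i) c) a (rev w) 1.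
  rewrite exchange_big mul_suml mul_sumr -sumrB /=.
  rewrite big_seq [RHS]big_seq; apply: eq_bigr => w wf.
  rewrite assoc_scaleAl assoc_scaleAr -scalerBr -scaler_sumr sum_coefr1_comm//.
    exact: undup_uniq.
  by move=> i; rewrite mem_rev; apply: mem_vars.
rewrite big_seq; apply: (subspace_sum subV) => i _; exact: V1.
Qed.

Lemma eval_upd_add n (t : K) i a b :
  (forall w, w \in msupp f -> (deg_mon i w < n)%N) ->
  eval f (upd a i (a i + t *: b)) =
  \sum_(j < n) t ^+ j *: \sum_(w <- msupp f) f@_w *: coefr i b a (rev w) j.
Proof.
move=> fn; rewrite -evalP_predT /evalP.
under [RHS]eq_bigr do rewrite scaler_sumr.
rewrite exchange_big big_seq [RHS]big_seq; apply: eq_bigr => w wf /=.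
rewrite (@evr_upd_add _ _ _ _ _ _ n) ?count_rev ?fn// scaler_sumr.
by apply: eq_bigr => j _; rewrite !scalerA mulrC.
Qed.

Lemma coefr_gt_sum n i a b : (forall w, w \in msupp f -> (deg_mon i w < n)%N) ->
  \sum_(w <- msupp f) f@_w *: coefr i b a (rev w) n = 0.
Proof.
move=> fn; rewrite big_seq big1// => w /fn dw.
by rewrite coefr_gt ?scaler0 ?count_rev.
Qed.

Lemma coefr1_subspace V n (t : 'I_n -> K) i : is_subspace V -> injective t ->
  (forall w, w \in msupp f -> (deg_mon i w < n)%N) ->
  (forall a, V (eval f a)) ->
  forall a b, V (\sum_(w <- msupp f) f@_w *: coefr i b a (rev w) 1).
Proof.
(* If [n] is at most 1, the variable does not occur and the coefficient of [t] is 0. *)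
move=> subV tinj fn fV a b; have [n1|n1] := ltnP 1 n; last first.
  rewrite coefr_gt_sum; first exact: subV.1.
  by move=> w /fn /leq_trans; apply.
pose u (j : 'I_n) := \sum_(w <- msupp f) f@_w *: coefr i b a (rev w) j.
apply: (@vandermonde_subspace _ _ _ _ _ u subV tinj _ (Ordinal n1)) => k.
by rewrite -eval_upd_add.
Qed.

(* When [f] is homogeneous of degree [d] in [x_i], the coefficient of [t^d] is
   itself a value of [f], so [d] scalars suffice for the others. *)
Lemma coefr1_subspace_homog V d (t : 'I_d -> K) i : is_subspace V ->
  injective t -> (forall w, w \in msupp f -> deg_mon i w = d) ->
  (forall a, V (eval f a)) ->
  forall a b, V (\sum_(w <- msupp f) f@_w *: coefr i b a (rev w) 1).
Proof.
move=> subV tinj fd fV a b.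
pose u j := \sum_(w <- msupp f) f@_w *: coefr i b a (rev w) j.
have Vd : V (u d).
  have := fV (upd a i b); congr V; rewrite -evalP_predT /evalP /u.
  rewrite big_seq [RHS]big_seq; apply: eq_bigr => w /fd <-.
  by rewrite -coefr_top count_rev.
(* For [d = 1] the coefficient sought is the top one; for [d = 0] it vanishes; otherwise the top
   term is subtracted, which leaves a Vandermonde system of size [d]. *)
have [d1|d1|d1] := ltngtP 1 d; last by rewrite -/(u 1%N) d1.
  apply: (@vandermonde_subspace _ _ _ _ _ (u \o val) subV tinj _ (Ordinal d1)).
  move=> k; rewrite -[X in V X](addrK (t k ^+ d *: u d)).
  apply: (subspaceB subV); last exact: (subspaceZ subV).
  have := fV (upd a i (a i + t k *: b)); rewrite (@eval_upd_add d.+1).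
    by rewrite big_ord_recr.
  by move=> w /fd->.
rewrite coefr_gt_sum; first exact: subV.1.
by move=> w /fd->.
Qed.

Lemma evalP_algebraic s P i j : (0 < j)%N ->
  (forall v c, span s v -> span s (comm v c)) ->
  (forall a, span s (evalP P a)) ->
  (forall w, w \in msupp f -> P w -> deg_mon i w = j) ->
  forall a, algebraic (evalP P a).
Proof.
move=> j0 s_lie Ps Pj a; set v := evalP P a; set z := v ** v.
apply: (lie_ideal_algebraic s_lie (Ps a) j0
  (y := fun k => evalP P (upd a i (iter k (mulL z) (a i))))).
  by move=> k; apply: Ps.
move=> k J Jid Jz; have -> : iter (k * j) (mulL z) v =
    \sum_(w <- msupp f | P w) f@_w *: iter (k * j) (mulL z) (evr a (rev w)).
  rewrite /v /evalP; elim: (k * j)%N => //= n ->.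
  by rewrite /mulL mul_sumr; apply: eq_bigr => w _; rewrite assoc_scaleAr.
rewrite /evalP -sumrB; apply: (subspace_sum Jid.1) => w wf Pw.
rewrite -scalerBr; apply: (subspaceZ Jid.1).
by rewrite -(Pj w)// /deg_mon -count_rev; apply: evr_upd_iter.
Qed.

(** Components are split by degree in one variable after another. A part of positive degree in the
    current variable has algebraic values; the part of degree 0 no longer involves it and is passed
    to the remaining variables. *)
Lemma evalP_span_algebraic s n (t : 'I_n -> K) :
  f@_mone = 0 -> injective t -> (max_deg f < n)%N ->
  (forall v c, span s v -> span s (comm v c)) ->
  (forall a, span s (eval f a)) ->
  forall a, subspace_gen (span s `&` @algebraic K A) (eval f a).
Proof.
move=> f0 tinj fn s_lie fs; have subs := subspace_gen_subspace [set` s].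
have fdn i w : w \in msupp f -> (deg_mon i w < n)%N.
  by move=> wf; apply: leq_ltn_trans (deg_mon_max i wf) fn.
suff PG (r : seq nat) P : (forall a, span s (evalP P a)) ->
    (forall w, w \in msupp f -> P w -> {subset (w : seq nat) <= r}) ->
    forall a, subspace_gen (span s `&` @algebraic K A) (evalP P a).
  move=> a; rewrite -evalP_predT; apply: (PG (vars f)).
    by move=> a'; rewrite evalP_predT.
  by move=> w wf _ i; apply: mem_vars.
elim: r P => [|i r IH] P Ps Pr a.
  (* With no variable left only the empty word remains, and [evr] sends it to 0. *)
  rewrite /evalP big_seq_cond big1; first exact: (subspace_gen_subspace _).1.
  move=> w /andP[wf Pw]; have := Pr w wf Pw.
  case wE: (w : seq nat) => [|l w'] wl; first by rewrite scaler0.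
  by have := wl l (mem_head _ _).
have -> : evalP P a =
    \sum_(j < n) evalP (fun w => P w && (deg_mon i w == j)) a.
  under [RHS]eq_bigr => j _ do rewrite /evalP big_mkcondr.
  rewrite exchange_big /evalP /= big_seq_cond [RHS]big_seq_cond.
  apply: eq_bigr => w /andP[wf _].
  rewrite (bigD1 (Ordinal (fdn i w wf)))//= eqxx big1 ?addr0// => j.
  by rewrite -val_eqE eq_sym /= => /negPf->.
apply: (subspace_sum (subspace_gen_subspace _)) => j _ _.
have PsV := evalP_split_deg subs tinj (fdn i) Ps j.
have [j0|j0] := posnP j; last first.
  apply: mem_gen; split; first exact: PsV.
  by apply: (evalP_algebraic (i := i) j0 s_lie PsV) => w _ /andP[_ /eqP].
apply: IH => // w wf /andP[Pw /eqP wj] l lw.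
have := Pr w wf Pw l lw; rewrite inE => /predU1P[li|//].
move: wj; rewrite j0 -li => /eqP; rewrite /deg_mon -leqn0 leqNgt -has_count.
by rewrite has_pred1 lw.
Qed.

End Values.

(** * Conciseness from the number of scalars *)

(** This isolates the two facts that depend on the available scalars: the coefficients of [t] stay
    in the span, and values are combinations of algebraic elements of the span. *)
Lemma concise_criterion (K : fieldType) (f : {free K}) :
  (forall (A : assocAlgType K) (s : seq A), (forall a, span s (eval f a)) ->
     (forall a i b, i \in vars f ->
       span s (\sum_(w <- msupp f) f@_w *: coefr i b a (rev w) 1)) /\
     ((forall v c, span s v -> span s (comm v c)) ->
      forall a, subspace_gen (span s `&` @algebraic K A) (eval f a))) ->
  algebraically_concise f.
Proof.
move=> fP A fdV; have /finite_dimensionalP[s Vs] := fdV.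
have fs a : span s (eval f a).
  by rewrite -Vs; apply: mem_gen; exists a.
have [f1 falg] := fP A s fs.
have subs := subspace_gen_subspace [set` s].
have s_lie v c : span s v -> span s (comm v c).
  rewrite -{1}Vs; move: v.
  apply: (@subspace_gen_sub _ _ _ [set v | span s (comm v c)]); last first.
    move=> _ [a _ <-]; apply: (values_lie_ideal subs) => i a' b.
    exact: f1.
  split=> [|d u v us vs]; first by rewrite /= mul0l mul0r subrr; apply: subs.1.
  rewrite /= assoc_mulDl assoc_mulDr assoc_scaleAl assoc_scaleAr.
  by rewrite opprD addrACA -scalerBr; apply: subs.2.
apply: finite_dimensional_subalgebra_gen => //; rewrite Vs.
  by move=> x y sx _; apply: s_lie.
by move=> _ [a _ <-]; apply: falg.
Qed.

Lemma card_le_ordinal_inj (T : Type) n : `I_n #<= [set: T] ->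
  exists t : 'I_n -> T, injective t.
Proof.
move=> /card_leP[g].
have h (k : 'I_n) : (k : nat) \in `I_n by rewrite inE /=.
exists (fun k => val (g (SigSub (h k)))) => k l /val_inj gkl.
have /(congr1 val) := @inj _ _ _ g _ _ (mem_setT _) (mem_setT _) gkl.
by move=> kl; apply: val_inj.
Qed.

Lemma algebraically_concise_scalars (K : fieldType) (f : {free K})
    (t : 'I_(max_deg f).+1 -> K) :
  f@_mone = 0 -> injective t -> algebraically_concise f.
Proof.
move=> f0 tinj; apply: concise_criterion => A s fs; split; last first.
  by move=> s_lie a; apply: evalP_span_algebraic tinj _ s_lie fs a.
move=> a i b _; apply: (coefr1_subspace _ tinj) => //.
  exact: subspace_gen_subspace.
by move=> w; apply: deg_mon_max.
Qed.

Lemma algebraically_concise_homogeneous (K : fieldType) (f : {free K})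
    (t : 'I_(max_deg f) -> K) :
  f@_mone = 0 -> injective t -> homogeneous f -> algebraically_concise f.
Proof.
move=> f0 tinj hf; apply: concise_criterion => A s fs.
have subs := subspace_gen_subspace [set` s].
split=> [a i b ivars|s_lie a].
  have [w0 w0f] : exists w0, w0 \in msupp f.
    by move: ivars; rewrite mem_undup => /flattenP[_ /mapP[w wf _] _]; exists w.
  apply: (coefr1_subspace_homog (d := deg_mon i w0)
    (t := t \o widen_ord (deg_mon_max i w0f)) subs) => //.
    by move=> k l /tinj /(congr1 val) /= /val_inj.
  by move=> w wf; apply: hf.
have [[w0 w0f]|f_empty] := pselect (exists w, w \in msupp f); last first.
  rewrite /eval big_seq big1; first exact: (subspace_gen_subspace _).1.
  by move=> w wf; case: f_empty; exists w.
(* The zero constant term excludes the empty word, so some variable has positive degree, the same in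
   all monomials; each value of [f] is then itself algebraic. *)
have [i iw0] : exists i, i \in (w0 : seq nat).
  case w0E: (w0 : seq nat) => [|i w]; last by exists i; apply: mem_head.
  move: w0f; rewrite -mcoeff_neq0.
  have -> : w0 = mone by apply: val_inj; rewrite /= w0E fm1.
  by rewrite f0 eqxx.
have ivars := mem_vars w0f iw0.
apply: mem_gen; split; first exact: fs.
rewrite -evalP_predT; apply: (evalP_algebraic (i := i) (j := deg_mon i w0) _ s_lie).
- by rewrite /deg_mon -has_count has_pred1.
- by move=> a'; rewrite evalP_predT.
- by move=> w wf _; apply: hf.
Qed.

Theorem theorem1p7 (K : fieldType) (f : {free K}) (hf0 : f@_mone = 0) :
  (`I_(max_deg f).+1 #<= [set: K] -> algebraically_concise f) /\
  (`I_(max_deg f) #<= [set: K] -> homogeneous f -> algebraically_concise f) /\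
  (infinite_set [set: K] \/ (finite_set [set: K] /\ multilinear f) ->
     algebraically_concise f).
Proof.
have general : `I_(max_deg f).+1 #<= [set: K] -> algebraically_concise f.
  by move=> /card_le_ordinal_inj[t]; apply: algebraically_concise_scalars.
split=> //; split=> [/card_le_ordinal_inj[t]|].
  exact: algebraically_concise_homogeneous.
case=> [/infiniteP Kinf|[_ ml]].
  by apply: general; apply: card_le_trans Kinf; apply: subset_card_le.
(* Multilinearity gives [max_deg f <= 1], so a single scalar suffices and a constant map is
   injective. *)
apply: (@algebraically_concise_homogeneous _ _ (fun=> 0)) => //; last first.
  by move=> i ivars w w' wf w'f; rewrite !(ml i ivars).
have m1 : (max_deg f <= 1)%N.
  rewrite /max_deg big_seq; apply/bigmax_leqP_seq => i _ ivars.
  by apply/bigmax_leqP_seq => w wf _; rewrite (ml i ivars).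
move=> k l _; apply: val_inj => /=.
have := leq_trans (ltn_ord k) m1; have := leq_trans (ltn_ord l) m1.
by rewrite !ltnS !leqn0 => /eqP-> /eqP->.
Qed.
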